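(* Let $\Bbbk$ be a field, $S=\Bbbk[x_1,\ldots,x_n]$, and let $I\subseteq S$ be a monomial ideal. If $\operatorname{pd}_S(S/I)=\operatorname{ht}(\mathcal{L}_I)$, then the LCM lattice $\mathcal{L}_I$ is strongly complemented.
   Context: The LCM lattice $\mathcal{L}_I$ of a monomial ideal $I$ is the set of least common multiples of subsets of its minimal monomial generators (the lcm of the empty set is $1$), ordered by divisibility; it is a finite lattice with join lcm. The height $\operatorname{ht}(L)$ of a finite lattice $L$ is the maximum length of a chain in $L$, where a chain with $k+1$ elements has length $k$. In a finite lattice $L$ with bottom $\hat 0$ and top $\hat 1$, atoms are the elements covering $\hat 0$ and coatoms are the elements covered by $\hat 1$. $L$ is strongly complemented if for every $x\in L$ there exist $y,z\in L$ such that $y$ is a meet of coatoms, $z$ is a join of atoms, $x\vee y=x\vee z=\hat 1$, and $x\wedge y=x\wedge z=\hat 0$. Empty meets and joins are allowed (the empty meet is $\hat 1$, the empty join is $\hat 0$). *)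

(* Defs.v *)
From HB Require Import structures.
From Stdlib Require Import Classical ClassicalEpsilon.
From mathcomp Require Import all_boot all_order all_algebra.
From mathcomp Require Import generic_quotient ring_quotient mpoly.

Set Implicit Arguments.
Unset Strict Implicit.
Unset Printing Implicit Defensive.

Import Order.TTheory GRing.Theory.
Local Open Scope ring_scope.

Section QuotientModule.
Local Open Scope quotient_scope.
Variables (R : pzRingType) (V : lmodType R) (W : submodClosed V).

Definition submod_pred (v : V) : bool := v \in W.

Fact submod_pred_zmod : zmod_closed submod_pred.
Proof.
split=> [|u v Wu Wv]; first exact: rpred0.
by rewrite unfold_in -scaleN1r; apply: rpredD; last apply: rpredZ.
Qed.

HB.instance Definition _ := GRing.isZmodClosed.Build V submod_pred
  submod_pred_zmod.

Definition quotmod : Type := Quotient.quot (GRing.ZmodClosed.clone V submod_pred _).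

HB.instance Definition _ := GRing.Zmodule.on quotmod.
HB.instance Definition _ : EqQuotient V (Quotient.equiv (GRing.ZmodClosed.clone V submod_pred _)) quotmod :=
  EqQuotient.on quotmod.


Definition quotmod_scale (a : R) (x : quotmod) : quotmod :=
  \pi_quotmod (a *: repr x).

Lemma quotmod_eq (u v : V) : (u == v %[mod quotmod]) = (u - v \in W).
Proof. by rewrite -Quotient.idealrBE. Qed.

Lemma quotmod_scale_pi a v :
  quotmod_scale a (\pi_quotmod v) = \pi_quotmod (a *: v).
Proof.
apply/eqP; rewrite quotmod_eq -scalerBr rpredZ //.
by rewrite -quotmod_eq reprK.
Qed.

Lemma quotmod_piD (u v : V) :
  \pi_quotmod (u + v) = \pi_quotmod u + \pi_quotmod v.
Proof.
exact: (@pi_addr _ _ _ _ _ (Quotient.quot (GRing.ZmodClosed.clone V submod_pred _))).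
Qed.

Fact quotmod_scaleA a b x :
  quotmod_scale a (quotmod_scale b x) = quotmod_scale (a * b) x.
Proof. by rewrite -[x]reprK !quotmod_scale_pi scalerA ?reprK. Qed.

Fact quotmod_scale1 : left_id 1 quotmod_scale.
Proof. by move=> x; rewrite -[x]reprK !quotmod_scale_pi scale1r ?reprK. Qed.

Fact quotmod_scaleDr : right_distributive quotmod_scale +%R.
Proof.
move=> a x y; rewrite -[x]reprK -[y]reprK.
by rewrite -quotmod_piD !quotmod_scale_pi scalerDr ?reprK quotmod_piD ?reprK.
Qed.

Fact quotmod_scaleDl x : {morph quotmod_scale^~ x : a b / a + b}.
Proof.
by move=> a b; rewrite -[x]reprK !quotmod_scale_pi scalerDl quotmod_piD ?reprK.
Qed.

HB.instance Definition _ := GRing.Zmodule_isLmodule.Build R quotmod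
  quotmod_scaleA quotmod_scale1 quotmod_scaleDr quotmod_scaleDl.

End QuotientModule.

Section ProjectiveDimension.
Variable R : pzRingType.

Definition surjective_lin (A B : lmodType R) (g : {linear A -> B}) : Prop :=
  forall b, exists a, g a = b.

Definition exact_at (A B C : lmodType R)
    (f : {linear A -> B}) (g : {linear B -> C}) : Prop :=
  forall b, g b = 0 <-> exists a, f a = b.

Definition projective (P : lmodType R) : Prop :=
  forall (A B : lmodType R) (g : {linear A -> B}) (f : {linear P -> B}),
    surjective_lin g -> exists h : {linear P -> A}, forall x, g (h x) = f x.

Definition has_proj_resolution (M : lmodType R) (d : nat) : Prop :=
  exists (P : nat -> lmodType R) (del : forall i, {linear P i.+1 -> P i})
         (eps : {linear P 0 -> M}),
  [/\ forall i, projective (P i),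
      surjective_lin eps,
      exact_at (del 0) eps,
      forall i, exact_at (del i.+1) (del i)
    & forall i, (d < i)%N -> forall x : P i, x = 0].

(* A relation rather than a function, as the dimension may be infinite.  The
   zero module has dimension 0 under this convention. *)
Definition proj_dim (M : lmodType R) (d : nat) : Prop :=
  has_proj_resolution M d /\
  forall e, has_proj_resolution M e -> (d <= e)%N.

End ProjectiveDimension.

Section FiniteLattices.
Local Open Scope order_scope.
Variables (disp : Order.disp_t) (L : finTBLatticeType disp).
Implicit Types (x y : L) (C : {set L}).

Definition covers x y : bool := (x < y) && [forall z : L, ~~ (x < z < y)].

Definition atoms : {set L} := [set a : L | covers \bot a].

Definition coatoms : {set L} := [set c : L | covers c \top].

Definition is_chain C : bool := [forall x in C, forall y in C, x >=< y].

Definition height : nat := \max_(C : {set L} | is_chain C) #|C|.-1.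

Definition strongly_complemented : Prop :=
  forall x, exists y z,
    [/\ exists2 A : {set L}, A \subset coatoms & y = \meet_(c in A) c,
        exists2 B : {set L}, B \subset atoms & z = \join_(a in B) a,
        x `|` y = \top /\ x `|` z = \top
      & x `&` y = \bot /\ x `&` z = \bot].

End FiniteLattices.

Section LcmClosure.
Variable n : nat.
Implicit Types (m : 'X_{1..n}) (G : seq 'X_{1..n}).

Lemma lepm_anti m1 m2 : (m1 <= m2)%MM -> (m2 <= m1)%MM -> m1 = m2.
Proof.
move=> /mnm_lepP h1 /mnm_lepP h2; apply/mnmP=> i.
by apply/eqP; rewrite eqn_leq h1 h2.
Qed.

Lemma le0m m : (0 <= m)%MM.
Proof. by apply/mnm_lepP=> i; rewrite mnm0E. Qed.

Lemma mlcm_bigP (J : finType) (P : pred J) (F : J -> 'X_{1..n}) m :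
  reflect (forall j, P j -> (F j <= m)%MM)
          ((\big[@mlcm n/0%MM]_(j | P j) F j) <= m)%MM.
Proof.
have -> : (\big[@mlcm n/0%MM]_(j | P j) F j <= m)%MM
        = \big[andb/true]_(j | P j) (F j <= m)%MM.
  apply: (big_morph (fun p => (p <= m)%MM)) => [p q|]; last exact: le0m.
  exact: lem_mlcm.
rewrite big_andE; apply: (iffP forallP) => H j; last first.
  by apply/implyP; exact: H.
by apply/implyP; exact: H.
Qed.

Definition lcms G : seq 'X_{1..n} :=
  [seq \big[@mlcm n/0%MM]_(g in A) val g | A : {set seq_sub G}].

Lemma big_lcms_closed G (J : finType) (P : pred J) (F : J -> 'X_{1..n}) :
  (forall j, F j \in lcms G) ->
  \big[@mlcm n/0%MM]_(j | P j) F j \in lcms G.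
Proof.
move=> FG; set M := \big[_/_]_(_ | _) _.
apply/imageP; exists [set g : seq_sub G | (val g <= M)%MM] => //.
apply: lepm_anti; last by apply/mlcm_bigP => g; rewrite inE.
apply/mlcm_bigP => j Pj; have /imageP[A _ Fj] := FG j.
rewrite Fj; apply/mlcm_bigP => g gA.
have gM : (val g <= M)%MM.
  apply: (lepm_trans (m2 := F j)).
    by rewrite Fj; have /mlcm_bigP/(_ g gA) := lepm_refl
      (\big[@mlcm n/0%MM]_(g in A) val g).
  by have /mlcm_bigP/(_ j Pj) := lepm_refl M.
have /mlcm_bigP := lepm_refl (\big[@mlcm n/0%MM]_(g in [set g : seq_sub G | (val g <= M)%MM]) val g).
by apply; rewrite inE.
Qed.

(* Dickson's lemma *)
Lemma dickson_coord (j : nat) (P : 'X_{1..n} -> Prop) :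
  exists s : seq 'X_{1..n}, (forall m, m \in s -> P m) /\
    forall m, P m -> exists2 m', m' \in s &
      forall i : 'I_n, (i < j)%N -> (m' i <= m i)%N.
Proof.
elim: j P => [|j IHj] P.
  case: (classic (exists m, P m)) => [[m Pm]|nP].
    by exists [:: m]; split=> [p|p _]; [rewrite inE => /eqP->|exists m; rewrite ?inE].
  by exists [::]; split=> // m Pm; case: nP; exists m.
case: (leqP n j) => [le_nj|lt_jn].
  have [s [sP sB]] := IHj P; exists s; split=> // m /sB[m' sm' le].
  by exists m' => // i _; apply: le; apply: leq_trans le_nj.
pose o := Ordinal lt_jn.
have [s [sP sB]] := IHj P.
pose N := \max_(m <- s) m o.
have [t [tP tB]] : exists t : seq 'X_{1..n}, (forall m, m \in t -> P m) /\
    forall m, P m -> (m o < N)%N -> exists2 m', m' \in t &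
      forall i : 'I_n, (i < j.+1)%N -> (m' i <= m i)%N.
  elim: (N) => [|v [t [tP tB]]]; first by exists [::].
  have [u [uP uB]] := IHj (fun m => P m /\ m o = v).
  exists (t ++ u); split=> [m|m Pm].
    by rewrite mem_cat => /orP[/tP//|/uP[]].
  rewrite ltnS leq_eqVlt => /orP[/eqP mv|/(tB m Pm)[m' tm' le]]; last first.
    by exists m'; rewrite // mem_cat tm'.
  have [m' um' le] := uB m (conj Pm mv).
  exists m'; rewrite ?mem_cat ?um' ?orbT // => i.
  rewrite ltnS leq_eqVlt => /orP[/eqP ij|]; last exact: le.
  have -> : i = o by apply: val_inj.
  by have [_ ->] := uP _ um'; rewrite mv.
exists (s ++ t); split=> [m|m Pm].
  by rewrite mem_cat => /orP[/sP|/tP].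
case: (ltnP (m o) N) => [/(tB m Pm)[m' tm' le]|leN].
  by exists m'; rewrite // mem_cat tm' orbT.
have [m' sm' le] := sB m Pm.
exists m'; rewrite ?mem_cat ?sm' // => i.
rewrite ltnS leq_eqVlt => /orP[/eqP ij|]; last exact: le.
have -> : i = o by apply: val_inj.
apply: leq_trans leN; rewrite /N.
by rewrite (big_rem _ sm') /= leq_maxl.
Qed.

Lemma dickson (P : 'X_{1..n} -> Prop) :
  exists s : seq 'X_{1..n}, (forall m, m \in s -> P m) /\
    forall m, P m -> exists2 m', m' \in s & (m' <= m)%MM.
Proof.
have [s [sP sB]] := dickson_coord n P; exists s; split=> // m /sB[m' sm' le].
by exists m' => //; apply/mnm_lepP => i; apply: le.
Qed.

End LcmClosure.

Section MonomialIdeals.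
Variables (k : fieldType) (n : nat).
Notation S := {mpoly k[n]}.

(* Ideals of S are the submodules of the regular module S^o; the unit ideal
   is allowed. *)
Implicit Types I : submodClosed S^o.

Definition monomial_ideal I : Prop :=
  exists G : 'X_{1..n} -> Prop, forall p : S,
    p \in I <->
    exists2 s : seq (S * 'X_{1..n}),
      forall q, q \in s -> G q.2 & p = \sum_(q <- s) q.1 * 'X_[q.2].

(* For a monomial ideal, the monomials of I minimal for divisibility form its
   unique minimal set of monomial generators; it is finite by Dickson's lemma. *)
Definition min_mon_gen I (m : 'X_{1..n}) : Prop :=
  ('X_[m] : S) \in I /\
  forall m', ('X_[m'] : S) \in I -> (m' <= m)%MM -> m' = m.

Lemma min_mon_gens_exist I :
  exists s : seq 'X_{1..n}, uniq s /\ forall m, m \in s <-> min_mon_gen I m.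
Proof.
have [s [sP sB]] := dickson (fun m => ('X_[m] : S) \in I).
pose t := [seq m <- s | excluded_middle_informative (min_mon_gen I m) : bool].
exists (undup t); split=> [|m]; first exact: undup_uniq.
rewrite mem_undup mem_filter; split=> [/andP[]|mI].
  by case: excluded_middle_informative.
case: excluded_middle_informative => //= _.
have [m' sm' le] := sB m mI.1.
by rewrite -(mI.2 m' (sP _ sm') le).
Qed.

Definition min_mon_gens I : seq 'X_{1..n} :=
  sval (constructive_indefinite_description _ (min_mon_gens_exist I)).

Lemma min_mon_gensP I m : m \in min_mon_gens I <-> min_mon_gen I m.
Proof.
by rewrite /min_mon_gens; case: constructive_indefinite_description => s [].
Qed.

Lemma min_mon_gens_uniq I : uniq (min_mon_gens I).
Proof.
by rewrite /min_mon_gens; case: constructive_indefinite_description => s [].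
Qed.

End MonomialIdeals.

Fact lcm_display : Order.disp_t. Proof. exact: Order.Disp tt tt. Qed.

Section LcmLattice.
Variables (k : fieldType) (n : nat) (I : submodClosed {mpoly k[n]}^o).

Definition lcm_lattice : Type := seq_sub (lcms (min_mon_gens I)).

HB.instance Definition _ := Finite.on lcm_lattice.
HB.instance Definition _ := SubType.on lcm_lattice.

Implicit Types x y z : lcm_lattice.

Definition lcm_le x y : bool := (val x <= val y)%MM.

Fact lcm_le_refl : reflexive lcm_le.
Proof. by move=> x; exact: lepm_refl. Qed.

Fact lcm_le_anti : antisymmetric lcm_le.
Proof. by move=> x y /andP[le1 le2]; apply/val_inj/lepm_anti. Qed.

Fact lcm_le_trans : transitive lcm_le.
Proof. by move=> y x z; exact: lepm_trans. Qed.

HB.instance Definition _ := Order.Le_isPOrder.Build lcm_display lcm_lattice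
  lcm_le_refl lcm_le_anti lcm_le_trans.

Lemma lcm_leE x y : (x <= y)%O = (val x <= val y)%MM.
Proof. by []. Qed.

Definition lcm_big (P : pred lcm_lattice) : lcm_lattice :=
  SeqSub (big_lcms_closed P (fun x => valP x)).

Lemma lcm_bigP P x : (lcm_big P <= x)%O = [forall z, P z ==> (z <= x)%O].
Proof.
apply/mlcm_bigP/forallP => [H z|H z Pz]; first by apply/implyP => /H.
by have /implyP/(_ Pz) := H z.
Qed.

Definition lcm_join x y : lcm_lattice := lcm_big (pred2 x y).

(* The meet is not the gcd, which need not belong to the LCM lattice. *)
Definition lcm_meet x y : lcm_lattice :=
  lcm_big (fun z => (z <= x)%O && (z <= y)%O).

Fact lcm_meetP x y z : (x <= lcm_meet y z)%O = (x <= y)%O && (x <= z)%O.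
Proof.
apply/idP/idP => [le|le].
  by apply/andP; split; apply: (le_trans le); rewrite lcm_bigP;
     apply/forallP => w; apply/implyP => /andP[].
have := lexx (lcm_meet y z); rewrite {1}lcm_bigP => /forallP/(_ x).
by rewrite le.
Qed.

Fact lcm_joinP x y z : (lcm_join x y <= z)%O = (x <= z)%O && (y <= z)%O.
Proof.
rewrite lcm_bigP; apply/forallP/andP => [H|[xz yz] w].
  by split; [have := H x | have := H y]; rewrite /= eqxx ?orbT.
by apply/implyP => /orP[] /eqP->.
Qed.

HB.instance Definition _ := Order.POrder_MeetJoin_isLattice.Build
  lcm_display lcm_lattice lcm_meetP lcm_joinP.

Fact lcm_bottomP x : (lcm_big pred0 <= x)%O.
Proof. by rewrite lcm_bigP; apply/forallP. Qed.

HB.instance Definition _ := Order.hasBottom.Build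
  lcm_display lcm_lattice lcm_bottomP.

Fact lcm_topP x : (x <= lcm_big predT)%O.
Proof.
have := lexx (lcm_big predT).
by rewrite {1}lcm_bigP => /forallP/(_ x).
Qed.

HB.instance Definition _ := Order.hasTop.Build
  lcm_display lcm_lattice lcm_topP.

Lemma val_lcm_bottom : val (\bot%O : lcm_lattice) = 0%MM.
Proof. by rewrite /= big_pred0. Qed.

Lemma val_lcm_join x y : val (x `|` y)%O = mlcm (val x) (val y).
Proof.
apply: lepm_anti; first by apply/mlcm_bigP => z /orP[] /eqP->;
  rewrite ?lem_mlcml ?lem_mlcmr.
by rewrite lem_mlcm; apply/andP; split; [exact: (leUl x y)|exact: (leUr y x)].
Qed.

End LcmLattice.

(* Main.v *)
From HB Require Import structures.
Require Import Defs.
From mathcomp Require Import all_boot all_order all_algebra mpoly.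
From mathcomp Require Import zify.
From Stdlib Require Import Classical ClassicalEpsilon.

(** Let h be the height of the LCM lattice L.  The chains 0 < x_1 < ... < x_i
    of L, placed in degree x_i, index a graded free resolution F of S/I: in
    multidegree m it is contracted by coning with the largest element of L
    dividing m.  All chains of length h end in the top 1, so the part of
    F_h -> F_{h-1} landing on chains ending in 1 is a scalar matrix.  If this
    matrix is injective, then F_h -> F_{h-1} splits and S/I has a projective
    resolution of length h - 1.  Hence pd S/I = h yields a nonzero scalar cycle
    on the maximum-length chains; each chain in its support can be modified at
    any prescribed interior position without leaving the support.  Any nonempty
    set of saturated chains with this exchange property provides, for each x, a
    complement which is a meet of coatoms, by induction on the length of the
    interval, replacing 0 by an atom a with a </= x.  Joins of atoms follow by
    duality. *)

Set Implicit Arguments.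
Unset Strict Implicit.
Unset Printing Implicit Defensive.

Import Order.TTheory GRing.Theory.
Local Open Scope ring_scope.

(** * Kernels, projective resolutions and their truncation at a split differential *)

Section Kernel.
Variables (R : pzRingType) (A B : lmodType R) (f : {linear A -> B}).

Definition kerlin : {pred A} := fun x => f x == 0.

Fact kerlin_submod : submod_closed kerlin.
Proof.
split=> [|a u v]; rewrite !unfold_in ?linear0 // => /eqP fu /eqP fv.
by rewrite linearP fu fv scaler0 addr0.
Qed.

HB.instance Definition _ := GRing.isSubmodClosed.Build R A kerlin kerlin_submod.

Definition kermod : Type := {x : A | x \in kerlin}.
HB.instance Definition _ := SubChoice.on kermod.
HB.instance Definition _ := [SubChoice_isSubLmodule of kermod by <:].

End Kernel.

Section Resolutions.
Variable R : pzRingType.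
Implicit Types M K P : lmodType R.

Lemma projective_triv P : (forall x : P, x = 0) -> projective P.
Proof.
move=> P0 A B g f _; exists \0 => x.
by rewrite [x]P0 !linear0.
Qed.

Lemma projective_retract P M (s : {linear M -> P}) (q : {linear P -> M}) :
  projective P -> cancel s q -> projective M.
Proof.
move=> pP sK A B g f /(pP _ _ g (f \o q))[h hE].
by exists (h \o s) => x /=; rewrite hE /= sK.
Qed.

Lemma has_proj_resolution0 M : projective M -> has_proj_resolution M 0.
Proof.
move=> pM; pose P i : lmodType R := if i is 0 then M else 'rV[R]_0.
have P0 i (x : P i.+1) : x = 0 by apply: thinmx0.
have pP i : projective (P i) by case: i => // i; apply/projective_triv/P0.
pose del i : {linear P i.+1 -> P i} := \0.
pose eps : {linear P 0 -> M} := idfun.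
exists P, del, eps; split=> //.
- by move=> b; exists b.
- by move=> b; split=> [b0|[a <-]//]; exists 0; rewrite linear0; exact: esym b0.
- by move=> i b; split=> // _; exists 0; rewrite linear0 (P0 _ b).
- by case.
Qed.

Lemma has_proj_resolutionS M K P (j : {linear K -> P}) (q : {linear P -> M}) d :
    injective j -> projective P -> surjective_lin q -> exact_at j q ->
  has_proj_resolution K d -> has_proj_resolution M d.+1.
Proof.
move=> inj_j pP sq ejq [Q [del [eps [pQ se e0 ee z]]]].
pose P' i : lmodType R := if i is i'.+1 then Q i' else P.
pose del' i : {linear P' i.+1 -> P' i} :=
  match i return {linear P' i.+1 -> P' i} with
  | 0 => (j \o eps) | i'.+1 => del i' end.
exists P', del', q; split=> //=.
- by case.
- move=> b; rewrite ejq; split=> [[a <-]|[a <-]]; last by exists (eps a).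
  by have [c <-] := se a; exists c.
- case=> [|i] b /=; last exact: ee.
  rewrite -e0; split=> [h|->]; last by rewrite linear0.
  by apply: inj_j; rewrite linear0.
- by case=> // i; rewrite ltnS; apply: z.
Qed.

(** Since [r] splits [d], the endomorphism [a - d (r a)] of [Q] kills the image of [d] and descends
    to a section of [q], so [M] is a retract of [Q]. *)
Lemma projective_coker (P Q M : lmodType R) (d : {linear P -> Q}) (q : {linear Q -> M})
    (r : {linear Q -> P}) :
    projective Q -> surjective_lin q -> exact_at d q -> cancel d r ->
  projective M.
Proof.
move=> pQ sq ex dK.
have /constructive_indefinite_description[s0 s0K] :
    exists s0 : M -> Q, cancel s0 q.
  exists (fun x => sval (constructive_indefinite_description _ (sq x))) => x.
  by case: constructive_indefinite_description.
(* [s0] is only a set-theoretic section; the correction makes the value independent of the chosen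
   lift, hence linear. *)
pose s x := s0 x - d (r (s0 x)).
have q_s a : s (q a) = a - d (r a).
  have /ex[b bE] : q (s0 (q a) - a) = 0 by rewrite linearB s0K subrr.
  rewrite /s; have -> : s0 (q a) = d b + a by rewrite bE subrK.
  by rewrite !linearD /= dK addrACA subrr add0r.
have s_lin : linear s.
  move=> c x y; rewrite -[x]s0K -[y]s0K -linearP !q_s [r _]linearP [d _]linearP.
  by rewrite scalerBr opprD addrACA.
pose sL : {linear M -> Q} :=
  HB.pack s (GRing.isLinear.Build R M Q _ s s_lin).
apply: (@projective_retract Q M sL q) => // x; rewrite /= /s linearB s0K.
by have /ex -> : exists a, d a = d (r (s0 x)); [exists (r (s0 x)) | rewrite subr0].
Qed.

(** The tail of the complex resolves [kermod eps], so induction on [e] moves the split differential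
    down to position 0, where [projective_coker] makes the resolved module itself projective. *)
Lemma has_proj_resolution_split (F : nat -> lmodType R)
    (del : forall i, {linear F i.+1 -> F i}) M (eps : {linear F 0 -> M}) e
    (r : {linear F e -> F e.+1}) :
    (forall i, projective (F i)) -> surjective_lin eps ->
    exact_at (del 0) eps -> (forall i, exact_at (del i.+1) (del i)) ->
  cancel (del e) r -> has_proj_resolution M e.
Proof.
elim: e => [|e IHe] in F del M eps r *.
  move=> pF se e0 _ /(projective_coker (pF 0) se e0).
  exact: has_proj_resolution0.
move=> pF se e0 ee rK.
have in_ker x : del 0 x \in kerlin eps by apply/eqP/e0; exists x.
pose eps' x : kermod eps := Sub (del 0 x) (in_ker x).
have eps'_lin : linear eps'.
  by move=> c x y; apply: val_inj; rewrite /= !linearP.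
pose epsL : {linear F 1 -> kermod eps} :=
  HB.pack eps' (GRing.isLinear.Build R _ _ _ eps' eps'_lin).
apply: (@has_proj_resolutionS M (kermod eps) (F 0) val eps) => //.
- exact: val_inj.
- move=> b; split=> [b0|[a <-]]; last by apply/eqP/(valP a).
  by exists (Sub b (introT eqP b0)).
apply: (IHe (fun i => F i.+1) (fun i => del i.+1) (kermod eps) epsL r) => //.
- case=> b bker; have /e0[a ab] := eqP bker.
  by exists a; apply: val_inj.
- move=> b; rewrite -ee; split=> [/(congr1 val)//|h].
  by apply: val_inj.
Qed.

End Resolutions.

(** * Complements from families of saturated chains with the exchange property *)

Section ThinChains.
Local Open Scope order_scope.
Variables (disp : Order.disp_t) (L : finTBLatticeType disp) (h : nat).
Implicit Types (x z a : L) (c : nat -> L) (T : (nat -> L) -> Prop).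

(** Only the indices from [q] to [h] are constrained, so that passing to an upper interval means
    raising [q], without reindexing the chain. *)
Definition saturated q c :=
  c h = \top /\ forall i, (q <= i < h)%N -> covers (c i) (c i.+1).

Definition thin q T := forall c i, T c -> (q < i < h)%N ->
  exists c', [/\ T c', c' i <> c i & forall j, (j <= h)%N -> j != i -> c' j = c j].

Lemma covers_lt x z : covers x z -> x < z.
Proof. by case/andP. Qed.

Lemma covers_between x z t : covers x z -> x <= t -> t <= z -> t = x \/ t = z.
Proof.
case/andP=> _ /forallP/(_ t); rewrite negb_and => H xt tz.
case: (eqVneq t x) => [|tx]; first by left.
case: (eqVneq t z) => [|zt]; first by right.
by move: H; rewrite !lt_neqAle [x == _]eq_sym tx zt xt tz.
Qed.

(* The first step at which a chain leaves the ideal below x can be lowered to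
   q + 1, as two distinct elements covered by c_(i+1), with c_(i+1) </= x,
   cannot both lie below x. *)
Lemma thin_avoids q T x c : (q < h)%N -> x != \top -> T c -> thin q T ->
  (forall c, T c -> saturated q c) -> exists2 c', T c' & ~~ (c' q.+1 <= x).
Proof.
move=> qh xt Tc thT satT.
suff main d : forall c, T c -> (q + d < h)%N -> ~~ (c (q + d).+1 <= x) ->
    exists2 c', T c' & ~~ (c' q.+1 <= x).
  apply: (main (h - q.+1)%N c) => //; first by lia.
  have -> : (q + (h - q.+1)).+1 = h by lia.
  by rewrite (satT _ Tc).1 le1x.
elim: d => [|d IHd] {Tc}c Tc dh nle; first by exists c; rewrite ?addn0 // in nle *.
have [cle|] := boolP (c (q + d).+1 <= x); last by apply: IHd => //; lia.
have [|c' [Tc' ne eqc]] := thT c (q + d).+1 Tc; first by lia.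
apply: (IHd c') => //; first by lia.
apply/negP => cle'; apply: ne.
have bnd c1 : T c1 -> covers (c1 (q + d).+1) (c1 (q + d).+2).
  by move=> /satT[_]; apply; lia.
have := bnd _ Tc; have := bnd _ Tc'; rewrite (eqc (q + d).+2); try lia.
move: nle; rewrite addnS => nle cov' cov.
have m_ne : x `&` c (q + d).+2 <> c (q + d).+2.
  by move=> e; move: nle; rewrite -e leIl.
have aux t : t <= x -> covers t (c (q + d).+2) -> t = x `&` c (q + d).+2.
  move=> tx ct; case: (covers_between (t := x `&` c (q + d).+2) ct) => //.
    by rewrite lexI tx ltW // (covers_lt ct).
  by rewrite leIr.
by rewrite (aux _ cle' cov') -(aux _ cle cov).
Qed.

(** Induction on the length [d] of the interval from [a] to [\top]. For [x != \top], take a vertex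
    [b] covering [a] and not below [x]. A complement [y], above [b], of the join of [x] and [b] also
    serves for [x]: the meet of [x] and [y] lies between [a] and [b], and is not [b]. *)
Lemma thin_complement d q T a : (q + d)%N = h -> (exists c, T c) -> thin q T ->
    (forall c, T c -> c q = a /\ saturated q c) ->
  forall x, a <= x -> exists A : {set L}, let y := \meet_(c in A) c in
    [/\ A \subset coatoms L, a <= y, x `|` y = \top & x `&` y = a].
Proof.
elim: d => [|d IHd] in q T a *.
  rewrite addn0 => -> [c Tc] _ /(_ c Tc)[ca [ct _]] x.
  have -> : a = \top by rewrite -ca.
  rewrite le1x => /eqP ->; exists set0.
  by rewrite /= big_set0; split; rewrite ?sub0set ?lexx ?joinx1 ?meetx1.
move=> qd [c0 Tc0] thT satT.
have qh : (q < h)%N by lia.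
have sat c : T c -> saturated q c by case/satT.
have cov c : T c -> covers a (c q.+1).
  by move=> Tc; have [<- [_ ->]] := satT c Tc; rewrite ?leqnn.
(* Prescribing the vertex at [q.+1] keeps the family thin at the later positions, so the induction
   hypothesis applies above that vertex. *)
have step c x : T c -> c q.+1 <= x -> exists A : {set L}, let y := \meet_(c in A) c in
    [/\ A \subset coatoms L, c q.+1 <= y, x `|` y = \top & x `&` y = c q.+1].
  move=> Tc; apply: (IHd q.+1 (fun c' => T c' /\ c' q.+1 = c q.+1)).
  - by lia.
  - by exists c.
  - move=> c1 i [Tc1 e] qi; have [|c2 [Tc2 ne eqc]] := thT c1 i Tc1; first by lia.
    by exists c2; split=> //; split=> //; rewrite eqc //; lia.
  - move=> c1 [/sat[t s] ->]; split=> //; split=> // i qi; apply: s; lia.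
(* For [x = \top], the element [a] itself must be a meet of coatoms: it is a coatom if [d = 0], and
   otherwise the meet of two distinct elements covering it, each a meet of coatoms by [step]. *)
move=> x ax; have [->|xt] := eqVneq x \top.
  have [dz|dz] := posnP d.
    have qE : q.+1 = h by lia.
    exists [set a]; rewrite /= big_set1 lexx join1x meet1x; split=> //.
    rewrite sub1set inE; have := cov _ Tc0.
    by rewrite qE (sat _ Tc0).1.
  have [|c1 [Tc1 ne _]] := thT c0 q.+1 Tc0; first by lia.
  have [A /= [Aco Ale _]] := step c0 \top Tc0 (lex1 _); rewrite meet1x => AE.
  have [B /= [Bco Ble _]] := step c1 \top Tc1 (lex1 _); rewrite meet1x => BE.
  exists (A :|: B); rewrite /= meets_setU AE BE join1x meet1x subUset Aco Bco.
  have aE : c0 q.+1 `&` c1 q.+1 = a.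
    have le1 : a <= c0 q.+1 `&` c1 q.+1.
      by rewrite lexI !ltW // covers_lt ?cov.
    case: (covers_between (cov _ Tc0) le1); rewrite ?leIl // => e.
    have le0 : c0 q.+1 <= c1 q.+1 by rewrite -e leIr.
    have [e'|e'] := covers_between (cov _ Tc1) (ltW (covers_lt (cov _ Tc0))) le0.
      by have := covers_lt (cov _ Tc0); rewrite e' ltxx.
    by case: ne.
  by rewrite aE lexx.
have [c1 Tc1 c1x] := thin_avoids qh xt Tc0 thT sat.
have [A /= [Aco Ale Aj Am]] := step c1 (x `|` c1 q.+1) Tc1 (leUr _ _).
have aA := le_trans (ltW (covers_lt (cov _ Tc1))) Ale.
exists A; rewrite /=; split=> //.
  by apply/eqP; rewrite -le1x -{1}Aj !leUx leUl leUr (le_trans Ale) ?leUr.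
have le1 : a <= x `&` \meet_(c in A) c by rewrite lexI ax aA.
have le2 : x `&` \meet_(c in A) c <= c1 q.+1 by rewrite -Am leI2 ?leUl.
case: (covers_between (cov _ Tc1) le1 le2) => // e.
by case/negP: c1x; rewrite -e leIl.
Qed.

End ThinChains.

Section ThinStronglyComplemented.
Local Open Scope order_scope.
Variables (disp : Order.disp_t) (L : finTBLatticeType disp) (h : nat).

Lemma covers_dual (x y : L) : covers (x : L^d) (y : L^d) = covers y x.
Proof.
rewrite /covers ltEdual; congr (_ && _).
by apply: eq_forallb => z; rewrite !ltEdual andbC.
Qed.

Lemma thin_strongly_complemented (T : (nat -> L) -> Prop) :
    (exists c, T c) -> thin h 0 T ->
    (forall c, T c -> c 0%N = \bot /\ saturated h 0 c) ->
  strongly_complemented L.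
Proof.
move=> exT thT satT x.
have [A /= [Aco _ Aj Am]] :=
  thin_complement (add0n h) exT thT satT (le0x x).
(* The chains of [T] read backwards are saturated in the dual lattice, whose coatoms are the atoms
   of [L]. *)
pose Td (c : nat -> L^d) := exists2 c0, T c0 & forall i, (i <= h)%N -> c i = c0 (h - i)%N.
have exTd : exists c, Td c.
  by have [c Tc] := exT; exists (fun i => c (h - i)%N), c.
have thTd : thin h 0 Td.
  move=> c i [c0 Tc0 cE] ih; have [|c1 [Tc1 ne eqc]] := thT c0 (h - i)%N Tc0; first by lia.
  exists (fun j => c1 (h - j)%N); split; first by exists c1.
    by rewrite cE; last lia.
  by move=> j jh ji; rewrite cE ?eqc //; lia.
have satTd c : Td c -> c 0%N = \bot /\ saturated h 0 c.
  move=> [c0 Tc0 cE]; have [c00 [c0h cov]] := satT _ Tc0.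
  split; first by rewrite cE // subn0.
  split; first by rewrite cE // subnn.
  move=> i ih; rewrite !cE ?covers_dual; try lia.
  have -> : (h - i)%N = (h - i.+1).+1 by lia.
  by apply: cov; lia.
have [B /= [Bco _ Bj Bm]] :=
  thin_complement (add0n h) exTd thTd satTd (le0x (x : L^d)).
have BL : (B : {set L}) \subset atoms L.
  apply/subsetP => b bB; have := subsetP Bco b bB.
  by rewrite !inE -covers_dual.
exists (\meet_(c in A) c), (\join_(c in (B : {set L})) c); split; first by exists A.
- by exists (B : {set L}).
- by split; [exact: Aj | exact: Bm].
- by split; [exact: Am | exact: Bj].
Qed.

End ThinStronglyComplemented.

(** * Chains of maximum length *)

Section Height.
Local Open Scope order_scope.
Variables (disp : Order.disp_t) (L : finTBLatticeType disp).

Definition incr r (c : nat -> L) := forall i, (i < r)%N -> c i < c i.+1.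

Lemma incr_lt r c i j : incr r c -> (i < j <= r)%N -> c i < c j.
Proof.
move=> inc; elim: j => [|j IHj] ij; first by lia.
have [e|ne] := eqVneq i j; first by rewrite e; apply: inc; lia.
by apply: (lt_trans (IHj _)); first lia; apply: inc; lia.
Qed.

Lemma incr_height r c : incr r c -> (r <= height L)%N.
Proof.
move=> inc; pose C := [set c i | i : 'I_r.+1].
have cinj : injective (fun i : 'I_r.+1 => c i).
  move=> i j /= e; apply: val_inj.
  have li := ltn_ord i; have lj := ltn_ord j.
  case: (ltngtP i j) => // ij.
    have lt : c i < c j by apply: (incr_lt inc); lia.
    by rewrite e ltxx in lt.
  have lt : c j < c i by apply: (incr_lt inc); lia.
  by rewrite e ltxx in lt.
have cardC : #|C|.-1 = r by rewrite card_imset // card_ord.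
rewrite -{1}cardC; apply: (leq_bigmax_cond (F := fun C : {set L} => #|C|.-1)).
apply/forall_inP => _ /imsetP[i _ ->]; apply/forall_inP => _ /imsetP[j _ ->].
have li := ltn_ord i; have lj := ltn_ord j.
case: (ltngtP i j) => [ij|ij|->]; last exact: comparablexx.
  by apply: lt_comparable; apply: (incr_lt inc); lia.
by rewrite comparable_sym; apply: lt_comparable; apply: (incr_lt inc); lia.
Qed.

(** Otherwise prepending [\bot], appending [\top] or inserting an intermediate element would produce
    a chain longer than the height. *)
Lemma incr_saturated c : incr (height L) c -> saturated (height L) 0 c /\ c 0%N = \bot.
Proof.
move=> inc.
have noext c' : ~ incr (height L).+1 c' by move/incr_height; rewrite ltnn.
split; last first.
  apply/eqP; apply: contraT; rewrite -lt0x => c0.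
  case: (noext (fun j => if j is j'.+1 then c j' else \bot)) => -[|i] //= ih.
  exact: inc.
split.
  apply/eqP; apply: contraT; rewrite -ltx1 => chain.
  case: (noext (fun j => if (j <= height L)%N then c j else \top)) => i ih.
  rewrite -ltnS ih; case: (leqP i.+1 _) => ih'; first exact: inc.
  by have -> : i = height L by lia.
move=> i ih; rewrite /covers inc //=; apply/forallP => z; apply/negP => /andP[iz zi].
case: (noext (fun j => if (j <= i)%N then c j else if j == i.+1 then z else c j.-1)).
move=> j jh; case: (ltngtP j i) => [ji|ji|->].
- by apply: inc; lia.
- have -> /= : (j.+1 == i.+1) = false by lia.
  case: eqP => [->//|ne]; have -> : j = j.-1.+1 by lia.
  by apply: inc; lia.
- by rewrite eqxx.
Qed.

End Height.

(** * The complex of chains starting at [\bot] and its contraction by cones *)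

Section BarComplex.
Variables (disp : Order.disp_t) (L : finTBLatticeType disp) (k : fieldType).

(* A labelled set indexes the basis of a free module; [lab] gives the degrees.
   [chain i] is the set of chains \bot < x_1 < ... < x_i labelled by x_i, a
   chain being nested as (((tt, x_1), ...), x_i). *)
Record labelled := Labelled { lab_car :> finType; lab : lab_car -> L }.

Definition extension_pred (A : labelled) := [pred p : A * L | lab p.1 < p.2]%O.
Definition ext (A : labelled) : labelled :=
  Labelled (fun p : {p : A * L | p \in extension_pred A} => (val p).2).

Fixpoint chain i : labelled :=
  if i is j.+1 then ext (chain j) else Labelled (fun _ : unit => \bot%O).

Definition init i (p : chain i.+1) : chain i := (val p).1.

(* The sign convention makes the chain without its last vertex appear with
   coefficient 1, so that coning with a larger element is a contraction. *)
Fixpoint bdry i : chain i.+1 -> chain i -> k :=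
  match i return chain i.+1 -> chain i -> k with
  | 0 => fun _ _ => 1
  | j.+1 => fun p q => ((init p) == q)%:R -
      (if lab q == lab p then bdry (init p) (init q) else 0)
  end.

Lemma init_lt i (p : chain i.+1) : (lab (init p) < lab p)%O.
Proof. exact: (valP p). Qed.

(** Dropping the last vertex is a bijection from the chains ending in [t] onto the shorter chains
    ending strictly below [t]. *)
Lemma sum_init i (t : L) (F : chain i -> k) :
  \sum_(p : chain i.+1 | lab p == t) F (init p) = \sum_(a : chain i | (lab a < t)%O) F a.
Proof.
rewrite -(big_sub_cond (extension_pred (chain i)) (fun p => p.2 == t) (fun p => F p.1)).
rewrite (eq_bigl (fun p : chain i * L => (lab p.1 < t)%O && (p.2 == t))); last first.
  by move=> [a x] /=; rewrite !inE /=; case: eqP => [->|]; rewrite ?andbF.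
rewrite -(pair_big_dep (fun a => lab a < t)%O (fun _ x => x == t) (fun a _ => F a)) /=.
by apply: eq_bigr => a _; rewrite big_pred1_eq.
Qed.

(** Every face other than [init p] keeps the last vertex of [p], hence its label. *)
Lemma bdry_eq i (p : chain i.+1) (q : chain i) :
  (lab q < lab p)%O -> bdry p q = ((init p) == q)%:R.
Proof.
case: i p q => [|i] p q lt /=; first by case: (init p) q {lt} => [] [].
by rewrite (lt_eqF lt) subr0.
Qed.

Lemma bdry_supp i (p : chain i.+1) (q : chain i) : bdry p q != 0 -> (lab q <= lab p)%O.
Proof.
case: i p q => [|i] p q /=; first by rewrite le0x.
case: (_ =P q) => [<- _|_]; first exact: ltW (init_lt p).
by case: (_ =P (val p).2) => [->//|_]; rewrite subrr eqxx.
Qed.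

Lemma sum_bdryS i (p : chain i.+2) (G : chain i.+1 -> k) :
  \sum_q bdry p q * G q =
  G (init p) - \sum_(q : chain i.+1 | lab q == lab p) bdry (init p) (init q) * G q.
Proof.
rewrite [X in _ = _ - X]big_mkcond.
have -> : G (init p) = \sum_q ((init p) == q)%:R * G q.
  rewrite (bigD1 (init p)) //= eqxx mul1r big1 ?addr0 // => q /negPf qp.
  by rewrite eq_sym qp mul0r.
rewrite -sumrB; apply: eq_bigr => q _; rewrite mulrBl.
by congr (_ - _); case: ifP; rewrite ?mul0r.
Qed.

(** The faces of [p] are [init p] and the faces of [init p] with [lab p] appended. The boundary of
    the former cancels against dropping [lab p] from the latter; what remains is the double boundary
    of [init p], zero by induction. *)
Lemma bdry_bdry i (p : chain i.+2) (r : chain i) : \sum_q bdry p q * bdry q r = 0.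
Proof.
elim: i => [|i IHi] in p r *; rewrite sum_bdryS.
  rewrite (eq_bigr (fun q : chain 1 => (fun _ : chain 0 => 1 : k) (init q))); last first.
    by move=> q _; rewrite mulr1.
  rewrite (sum_init (lab p) (fun _ : chain 0 => 1)).
  rewrite (big_pred1 (tt : chain 0)) ?subrr // => -[] /=.
  exact: (le_lt_trans (le0x _) (init_lt p)).
have lt q : bdry (init p) q != 0 -> (lab q < lab p)%O.
  by move=> /bdry_supp; move/le_lt_trans; apply; apply: init_lt.
rewrite (eq_bigr (fun q : chain i.+2 => (fun q' : chain i.+1 => bdry (init p) q' *
   ((q' == r)%:R - (if lab r == lab p then bdry q' (init r) else 0))) (init q))); last first.
  by move=> q /eqP qp; rewrite -qp.
rewrite (sum_init (lab p) (fun q' : chain i.+1 => bdry (init p) q' *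
   ((q' == r)%:R - (if lab r == lab p then bdry q' (init r) else 0)))).
(* Faces of [init p] end strictly below [lab p] anyway, so the condition on the label can be
   lifted. *)
rewrite big_rmcond; last first.
  by move=> q; apply: contraNeq => ne; apply: lt; apply: contraNneq ne => ->; rewrite mul0r.
apply/eqP; rewrite subr_eq0; apply/eqP.
under eq_bigr do rewrite mulrBr.
rewrite sumrB (bigD1 r) // eqxx mulr1 [X in _ + X - _]big1 ?addr0; last first.
  by move=> q /negPf ->; rewrite mulr0.
case: (lab r == lab p); last by rewrite big1 ?subr0 // => q _; rewrite mulr0.
by rewrite IHi subr0.
Qed.

Definition cone i (t : L) (f : chain i -> k) (p : chain i.+1) : k :=
  if lab p == t then f (init p) else 0.

(** If [q] ends below [t], only the chain [q] with [t] appended contributes. If [q] ends in [t], the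
    coefficient is minus the boundary at [init q] of the part of [f] ending below [t], which the
    cycle condition at [init q] turns into [f q]. *)
Lemma bdry_cone i (t : L) (f : chain i.+1 -> k) (q : chain i.+1) :
    (forall r : chain i, (lab r <= t)%O ->
       \sum_(p : chain i.+1 | (lab p <= t)%O) f p * bdry p r = 0) ->
    (lab q <= t)%O ->
  \sum_(p : chain i.+2 | (lab p <= t)%O) cone t f p * bdry p q = f q.
Proof.
move=> fcycle qt.
have -> : \sum_(p : chain i.+2 | (lab p <= t)%O) cone t f p * bdry p q =
  \sum_(p : chain i.+2 | lab p == t) (fun p' : chain i.+1 => f p' * ((p' == q)%:R -
      (if lab q == t then bdry p' (init q) else 0))) (init p).
  rewrite big_mkcond [RHS]big_mkcond; apply: eq_bigr => p _; rewrite /cone.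
  by case: (lab p =P t) => [<-|_]; rewrite ?lexx // mul0r if_same.
rewrite (sum_init t (fun p' : chain i.+1 => f p' * ((p' == q)%:R -
      (if lab q == t then bdry p' (init q) else 0)))).
under eq_bigr do rewrite mulrBr.
rewrite sumrB.
have -> : \sum_(a : chain i.+1 | (lab a < t)%O) f a * (a == q)%:R =
    if (lab q < t)%O then f q else 0.
  rewrite big_mkcond (bigD1 q) //= eqxx mulr1 big1 ?addr0 // => a /negPf ->.
  by rewrite mulr0 if_same.
have [qE|ne] := eqVneq (lab q) t; last first.
  by rewrite lt_neqAle ne qt big1 ?subr0 // => a _; rewrite mulr0.
rewrite qE ltxx sub0r.
have rt : (lab (init q) < t)%O by rewrite -qE; apply: init_lt.
(* Among the chains ending in [t], only [q] has [init q] as a face. *)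
have e1 : \sum_(p : chain i.+1 | (lab p <= t)%O && ~~ (lab p < t)%O) f p * bdry p (init q) = f q.
  rewrite (bigD1 q) ?qE ?lexx ?ltxx // bdry_eq ?qE // eqxx mulr1 big1; first exact: addr0.
  move=> p; rewrite lt_neqAle; case: (eqVneq (lab p) t) => //; last by case: (_ <= _)%O.
  move=> pE /andP[_ pq]; rewrite bdry_eq ?pE //.
  case: eqP => [e|]; rewrite ?mulr0 //; case/negP: pq; apply/eqP/val_inj.
  rewrite [LHS]surjective_pairing [RHS]surjective_pairing; congr pair; first exact: e.
  exact: etrans pE (esym qE).
have : \sum_(p : chain i.+1 | (lab p <= t)%O) f p * bdry p (init q) =
    \sum_(p : chain i.+1 | (lab p < t)%O) f p * bdry p (init q) + f q.
  rewrite (bigID (fun p : chain i.+1 => lab p < t)%O) /= -e1; congr (_ + _).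
  by apply: eq_bigl => p; apply: andb_idl; apply: ltW.
rewrite (fcycle _ (ltW rt)) => /esym/eqP.
by rewrite addrC addr_eq0 => /eqP ->.
Qed.

End BarComplex.

(** * Faces as deleted vertices, and exchange in the support of a cycle *)

Section VertexSequences.
Local Open Scope order_scope.
Variables (disp : Order.disp_t) (L : finTBLatticeType disp) (k : fieldType).
Local Notation chain := (@chain _ L).
Local Notation bdry := (@bdry _ L k _).

Fixpoint vertex i : chain i -> nat -> L :=
  match i return chain i -> nat -> L with
  | 0%N => fun _ _ => \bot
  | j.+1 => fun p l => if (l <= j)%N then vertex (init p) l else lab p
  end.

Lemma vertex_init i (p : chain i.+1) l : (l <= i)%N -> vertex p l = vertex (init p) l.
Proof. by move=> /= ->. Qed.

Lemma vertex_last i (p : chain i) : vertex p i = lab p.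
Proof. by case: i p => //= i p; rewrite ltnn. Qed.

Lemma vertex_incr i (p : chain i) : incr i (vertex p).
Proof.
elim: i p => [|i IHi] p l //; rewrite ltnS leq_eqVlt => /predU1P[->|li].
  by rewrite vertex_init // !vertex_last init_lt.
by rewrite (vertex_init _ (ltnW li)) (vertex_init _ li); apply: IHi.
Qed.

Lemma vertex_inj i (p q : chain i) :
  (forall j, (j <= i)%N -> vertex p j = vertex q j) -> p = q.
Proof.
elim: i p q => [|i IHi] p q e; first by case: p q {e} => [] [].
have e1 : init p = init q.
  by apply: IHi => j ji; rewrite -!vertex_init // e // ltnW.
have e2 : lab p = lab q by rewrite -!vertex_last e.
apply: val_inj; rewrite [LHS]surjective_pairing [RHS]surjective_pairing.
by congr pair; [exact: e1 | exact: e2].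
Qed.

(** [bump j] skips the index [j], so a face arises by deleting the vertex [j]; the vertex 0, which
    is [\bot], always stays. *)
Lemma bdry_vertex i (p : chain i.+1) (q : chain i) : bdry p q != 0%R ->
  exists2 j, (0 < j <= i.+1)%N &
    forall l, (l <= i)%N -> vertex q l = vertex p (bump j l).
Proof.
elim: i p q => [|i IHi] p q; first by exists 1%N => // -[].
have -> : bdry p q = ((init p == q)%:R -
  (if lab q == lab p then bdry (init p) (init q) else 0))%R by [].
case: (init p =P q) => [<- _|_].
  exists i.+2 => [|l li]; first by rewrite leqnn.
  have -> : bump i.+2 l = l by rewrite /bump; lia.
  by rewrite (vertex_init p).
case: (lab q =P lab p) => [qp|_]; last by rewrite subrr eqxx.
rewrite sub0r oppr_eq0 => /IHi[j ji jE]; exists j => [|l]; first by lia.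
rewrite leq_eqVlt => /predU1P[->|li].
  have -> : bump j i.+1 = i.+2 by rewrite /bump; lia.
  by rewrite !vertex_last.
by rewrite (vertex_init q) // (vertex_init p) ?jE // /bump; lia.
Qed.

Lemma bdry_face i (p : chain i.+1) j : (0 < j <= i.+1)%N ->
  exists2 q, bdry p q != 0%R &
    forall l, (l <= i)%N -> vertex q l = vertex p (bump j l).
Proof.
elim: i p => [|i IHi] p ji.
  have -> : j = 1%N by lia.
  by exists tt => [|[]//]; rewrite oner_neq0.
have [->|jne] := eqVneq j i.+2.
  exists (init p); first by rewrite bdry_eq ?init_lt // eqxx oner_neq0.
  move=> l li; have -> : bump i.+2 l = l by rewrite /bump; lia.
  by rewrite (vertex_init p).
(* To delete a vertex other than the last, delete it from [init p] and append [lab p] again; labels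
   still increase because those of faces never exceed that of the chain. *)
have [|q0 q0p q0E] := IHi (init p); first by lia.
have q0_lt : (q0, lab p) \in extension_pred (chain i).
  by rewrite inE /=; apply: (le_lt_trans (bdry_supp q0p)); apply: init_lt.
pose q : chain i.+1 := exist _ (q0, lab p) q0_lt.
exists q.
  have -> : bdry p q = ((init p == q)%:R -
    (if lab q == lab p then bdry (init p) (init q) else 0))%R by [].
  have -> : (init p == q) = false.
    by apply/eqP => e; have := init_lt p; rewrite e ltxx.
  by rewrite eqxx sub0r oppr_eq0.
move=> l; rewrite leq_eqVlt => /predU1P[->|li].
  have -> : bump j i.+1 = i.+2 by rewrite /bump; lia.
  by rewrite !vertex_last.
by rewrite (vertex_init q) // (vertex_init p) ?q0E // /bump; lia.
Qed.

(** The thin family is the support of [f]. Deleting an interior vertex leaves a face that still ends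
    in [\top], and the cycle condition at this face forces a second chain of the support to contain
    it. *)
Lemma top_cycle_strongly_complemented h (f : chain h.+1 -> k) p0 :
    height L = h.+1 -> f p0 != 0%R ->
    (forall q : chain h, lab q = \top -> (\sum_p f p * bdry p q)%R = 0%R) ->
  strongly_complemented L.
Proof.
move=> hE fp0 fcycle.
have sat (p : chain h.+1) : saturated h.+1 0 (vertex p) /\ vertex p 0%N = \bot.
  by have := @incr_saturated _ L (vertex p); rewrite hE; apply; apply: vertex_incr.
apply: (@thin_strongly_complemented _ L h.+1
  (fun c => exists2 p : chain h.+1, f p != 0%R & c = vertex p)).
- by exists (vertex p0), p0.
- move=> _ i [p fp ->] ih; have [|q qp qE] := @bdry_face h p i; first by lia.
  have q_top : lab q = \top.
    rewrite -vertex_last qE //; have -> : bump i h = h.+1 by rewrite /bump; lia.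
    by have [[]] := sat p.
  have [p' p'p fp'] : exists2 p', p' != p & (f p' * bdry p' q != 0)%R.
    apply/exists_inP; apply: contraT; rewrite negb_exists_in => /forall_inP H.
    have := fcycle q q_top; rewrite (bigD1 p) // big1.
      by move/eqP; rewrite /= addr0 mulf_eq0 (negPf fp) (negPf qp).
    by move=> p' /H; rewrite negbK => /eqP.
  move: fp'; rewrite mulf_eq0 negb_or => /andP[fp' /bdry_vertex[j jh jE]].
  (* If the positions differed, the vertex deleted at the smaller one would lie strictly between two
     consecutive vertices of the other chain, which is saturated. *)
  have ij : i = j.
    have bad (p1 p2 : chain h.+1) i1 i2 : (0 < i1)%N -> (i1 < i2 <= h.+1)%N ->
        (forall l, (l <= h)%N -> vertex q l = vertex p1 (bump i1 l)) ->
        (forall l, (l <= h)%N -> vertex q l = vertex p2 (bump i2 l)) -> False.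
      move=> i0 i12 E1 E2; have [[_ /(_ i1.-1)]] := sat p2.
      have := E1 i1.-1; have := E1 i1; rewrite E2 ?E2; try lia.
      have -> : bump i2 i1.-1 = i1.-1 by rewrite /bump; lia.
      have -> : bump i1 i1.-1 = i1.-1 by rewrite /bump; lia.
      have -> : bump i2 i1 = i1 by rewrite /bump; lia.
      have -> : bump i1 i1 = i1.+1 by rewrite /bump; lia.
      rewrite prednK // => -> //; last by lia.
      move=> -> ; last by lia.
      case/(_ _)/andP; first by lia.
      move=> _ /forallP/(_ (vertex p1 i1)); rewrite vertex_incr ?andbT; last by lia.
      have := @vertex_incr _ p1 i1.-1; rewrite prednK // => -> //; lia.
    case: (ltngtP i j) => // ij.
      by case: (bad p p' i j) => //; lia.
    by case: (bad p' p j i) => //; lia.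
  rewrite -{}ij in jE.
  have agree l : (l <= h.+1)%N -> l != i -> vertex p' l = vertex p l.
    move=> lh /eqP li; pose l' := if (l < i)%N then l else l.-1.
    have -> : l = bump i l' by rewrite /bump /l'; case: ifP; lia.
    by rewrite -jE ?qE // /l'; case: ifP; lia.
  exists (vertex p'); split=> //; first by exists p'.
  move=> e; case/eqP: p'p; apply: vertex_inj => l lh.
  by have [->//|li] := eqVneq l i; apply: agree.
- by move=> _ [p _ ->]; have [] := sat p.
Qed.

End VertexSequences.

(** * Free modules and scalar matrices *)

Section FreeModules.
Variables (R : pzRingType) (A : finType).

Lemma projective_ffun : projective ({ffun A -> R^o} : lmodType R).
Proof.
move=> M N g f sg.
pose dl a : {ffun A -> R^o} := [ffun b => (b == a)%:R].
have dlE (x : {ffun A -> R^o}) : x = \sum_a (x a : R) *: dl a.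
  apply/ffunP => b; rewrite sum_ffunE (bigD1 b) //= big1.
    by rewrite addr0 !ffunE eqxx /GRing.scale /= mulr1.
  by move=> a ab; rewrite !ffunE eq_sym (negPf ab) scaler0.
have /constructive_indefinite_description[h0 h0E] :
    exists h0 : A -> M, forall a, g (h0 a) = f (dl a).
  exists (fun a => sval (constructive_indefinite_description _ (sg (f (dl a))))).
  by move=> a; case: constructive_indefinite_description.
pose h (x : {ffun A -> R^o}) := \sum_a (x a : R) *: h0 a.
have h_lin : linear h.
  move=> c x y; rewrite /h scaler_sumr -big_split; apply: eq_bigr => a _.
  by rewrite !ffunE scalerDl scalerA.
pose hL : {linear {ffun A -> R^o} -> M} :=
  HB.pack h (GRing.isLinear.Build R _ M _ h h_lin).
exists hL => x /=.
rewrite /h [in RHS](dlE x) !linear_sum; apply: eq_bigr => a _.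
by rewrite !linearZ h0E.
Qed.

End FreeModules.

(** The two cases are full row rank or not. Matrices act on row vectors, so [N] is a left inverse of
    the map given by [M]. *)
Lemma left_inverse_or_kernel (k : fieldType) (A B : finType) (M : A -> B -> k) :
  (exists N : B -> A -> k, forall a a', \sum_b M a b * N b a' = (a == a')%:R) \/
  (exists2 f : A -> k, exists a, f a != 0 & forall b, \sum_a f a * M a b = 0).
Proof.
pose E := \matrix_(i < #|A|, j < #|B|) M (enum_val i) (enum_val j).
have [free|] := boolP (row_free E).
  left; exists (fun b a => pinvmx E (enum_rank b) (enum_rank a)) => a a'.
  have /matrixP/(_ (enum_rank a) (enum_rank a')) := mulmxVp free.
  rewrite !mxE (inj_eq enum_rank_inj) => <-.
  rewrite (reindex_onto enum_rank enum_val) => [|j _]; last exact: enum_valK.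
  apply: eq_big => [b|b _]; first by rewrite enum_rankK eqxx.
  by rewrite [E _ _]mxE !enum_rankK.
rewrite -kermx_eq0 => /rowV0Pn[v /sub_kermxP vE /rV0Pn[i vi]].
right; exists (fun a => v 0 (enum_rank a)).
  by exists (enum_val i); rewrite enum_valK.
move=> b; have /rowP/(_ (enum_rank b)) := vE.
rewrite !mxE => e; apply: etrans e.
rewrite [RHS](reindex_onto enum_rank enum_val) => [|j _]; last exact: enum_valK.
apply: eq_big => [a|a _]; first by rewrite enum_rankK eqxx.
by rewrite [E _ _]mxE !enum_rankK.
Qed.

(** * Multigraded maps given by scalar matrices *)

Section GradedMaps.
Variables (disp : Order.disp_t) (L : finTBLatticeType disp) (k : fieldType) (n : nat).
Variables (deg : L -> 'X_{1..n}) (flr : 'X_{1..n} -> L).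
(* [flr m] is the largest element of L of degree at most m. *)
Hypothesis degP : forall x m, (deg x <= m)%MM = (x <= flr m)%O.
Local Notation S := {mpoly k[n]}.
Local Notation F A := {ffun lab_car A -> S^o}.
Implicit Types A B C : labelled L.

Lemma deg_mono x y : (x <= y)%O -> (deg x <= deg y)%MM.
Proof. by move=> xy; rewrite degP (le_trans xy) // -degP lepm_refl. Qed.

Definition graded A B (M : A -> B -> k) :=
  forall a b, M a b != 0 -> (lab b <= lab a)%O.

(** The homogeneous map with scalar matrix [M]: the generator [a] has degree [deg (lab a)], and the
    monomial makes up the difference of degrees. The subtraction is truncated, but exact at nonzero
    entries when [M] is [graded]. *)
Definition gmap A B (M : A -> B -> k) (f : F A) : F B :=
  [ffun b => \sum_a (M a b *: 'X_[deg (lab a) - deg (lab b)]) * (f a : S)].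

Fact gmap_linear A B (M : A -> B -> k) : linear (gmap M).
Proof.
move=> c f g; apply/ffunP => b; rewrite !ffunE /GRing.scale /= mulr_sumr -big_split.
by apply: eq_bigr => a _; rewrite !ffunE mulrDr mulrCA.
Qed.
HB.instance Definition _ A B (M : A -> B -> k) :=
  GRing.isLinear.Build S (F A) (F B) _ (gmap M) (gmap_linear M).

Lemma gmap_comp A B C (M : A -> B -> k) (N : B -> C -> k) f :
  graded M -> graded N ->
  gmap N (gmap M f) = gmap (fun a c => \sum_b M a b * N b c) f.
Proof.
move=> gM gN; apply/ffunP => c; rewrite !ffunE.
under eq_bigr do rewrite ffunE mulr_sumr.
rewrite exchange_big; apply: eq_bigr => a _ /=.
rewrite scaler_suml mulr_suml; apply: eq_bigr => b _.
rewrite mulrA; congr (_ * _).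
have [->|/gM ba] := eqVneq (M a b) 0; first by rewrite scale0r mulr0 mul0r scale0r.
have [->|/gN cb] := eqVneq (N b c) 0; first by rewrite scale0r mulr0 mul0r scale0r.
rewrite -scalerAl -scalerAr scalerA mulrC -mpolyXD; congr (_ *: 'X_[_]).
rewrite addmC addmBA ?deg_mono // submK ?deg_mono //.
Qed.

Lemma gmap_id A f : gmap (fun a a' : A => (a == a')%:R) f = f.
Proof.
apply/ffunP => a; rewrite ffunE (bigD1 a) //= eqxx big1.
  by rewrite addr0 scale1r -[(_ - _)%MM]add0m addmBA ?lepm_refl // addmK mpolyX0 mul1r.
by move=> b /negPf ->; rewrite scale0r mul0r.
Qed.

Lemma gmap_eq A B (M N : A -> B -> k) f : (forall a b, M a b = N a b) -> gmap M f = gmap N f.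
Proof. by move=> e; apply/ffunP => b; rewrite !ffunE; apply: eq_bigr => a _; rewrite e. Qed.

Lemma gmap0 A B f : gmap (fun (a : A) (b : B) => 0) f = 0.
Proof. by apply/ffunP => b; rewrite !ffunE big1 // => a _; rewrite scale0r mul0r. Qed.

Definition in_degree A m (v : A -> k) : F A :=
  [ffun a => if (lab a <= flr m)%O then v a *: 'X_[m - deg (lab a)] else 0].

Lemma eq_in_degree A m (v w : A -> k) :
  (forall a, (lab a <= flr m)%O -> v a = w a) -> in_degree m v = in_degree m w.
Proof. by move=> e; apply/ffunP => a; rewrite !ffunE; case: ifP => // /e ->. Qed.

Lemma gmap_in_degree A B (M : A -> B -> k) m v : graded M ->
  gmap M (in_degree m v) =
  in_degree m (fun b => \sum_(a : A | (lab a <= flr m)%O) v a * M a b).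
Proof.
move=> gM; apply/ffunP => b; rewrite !ffunE.
transitivity (\sum_(a : A | (lab a <= flr m)%O)
    ((v a * M a b) *: 'X_[m - deg (lab b)] : S)).
  rewrite [RHS]big_mkcond; apply: eq_bigr => a _; rewrite ffunE.
  case: ifP => am; rewrite ?mulr0 //.
  have [->|/gM ba] := eqVneq (M a b) 0; first by rewrite scale0r mul0r mulr0 scale0r.
  rewrite -scalerAl -scalerAr scalerA mulrC -mpolyXD; congr (_ *: 'X_[_]).
  by rewrite addmC addmBA ?deg_mono // submK // degP.
case: ifP => bm; first by rewrite scaler_suml.
rewrite big1 // => a am; case: (eqVneq (M a b) 0) => [->|/gM ba].
  by rewrite mulr0 scale0r.
by rewrite (le_trans ba am) in bm.
Qed.

(** Meaningful only for [lab a] below [flr m]; elsewhere the truncated subtraction gives a junk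
    value, which [in_degree] discards. *)
Definition component A (f : F A) m (a : A) : k := ((f a : S)@_(m - deg (lab a))).

Lemma degree_decomposition A (f : F A) :
  exists N, f = \sum_(m : 'X_{1..n < N}) in_degree m (component f m).
Proof.
(* [msize] strictly exceeds the degree of each monomial of [f a], so [N] strictly bounds all
   multidegrees occurring in [f]. *)
pose N := \max_(a : A) (msize (f a : S) + mdeg (deg (lab a))).
exists N; apply/ffunP => a; rewrite sum_ffunE.
apply/mpolyP => u; rewrite linear_sum /=.
pose m0 := (u + deg (lab a))%MM.
transitivity (\sum_(m : 'X_{1..n < N}) (if bmnm m == m0 then (f a : S)@_u else 0)).
  have [lt|ge] := ltnP (mdeg m0) N.
    rewrite (bigD1 (BMultinom lt)) //= eqxx big1 ?addr0 // => m ne.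
    by rewrite ifN //; apply: contra ne => /eqP e; apply/eqP/val_inj.
  have fu : (f a : S)@_u = 0.
    apply: memN_msupp_eq0; apply/negP => /msize_mdeg_lt lt.
    move: ge; rewrite leqNgt => /negP; apply; rewrite /m0 mdegD.
    apply: (leq_trans (n := msize (f a : S) + mdeg (deg (lab a)))).
      by rewrite ltn_add2r.
    exact: (leq_bigmax (F := fun a => msize (f a : S) + mdeg (deg (lab a)))%N a).
  by rewrite fu big1 // => m _; rewrite if_same.
apply: eq_bigr => m _; rewrite ffunE -degP /component.
case: (boolP (deg (lab a) <= m)%MM) => am.
  rewrite mcoeffZ mcoeffX.
  have -> : (m - deg (lab a) == u)%MM = (bmnm m == m0).
    by rewrite -(eqm_add2r (deg (lab a))) submK.
  case: eqP => [->|]; rewrite ?mulr0 //.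
  by rewrite addmK mulr1.
rewrite mcoeff0 ifN //; apply: contra am => /eqP ->.
exact: lem_addl.
Qed.

Lemma mcoeffMX_cond (p : S) d e :
  (p * 'X_[d])@_e = if (d <= e)%MM then p@_(e - d) else 0.
Proof.
case: ifP => [de|nde]; first by rewrite -{1}(submK de) addmC mcoeffMX.
apply: memN_msupp_eq0; rewrite (perm_mem (msuppMX p d)).
by apply/mapP => -[m _ e']; rewrite e' lem_addr in nde.
Qed.

Lemma component_gmap A B (M : A -> B -> k) f m b : graded M -> (lab b <= flr m)%O ->
  component (gmap M f) m b =
  \sum_(a : A | (lab a <= flr m)%O) component f m a * M a b.
Proof.
move=> gM bm; rewrite /component ffunE linear_sum [RHS]big_mkcond /=.
apply: eq_bigr => a _.
rewrite -scalerAl mcoeffZ; case: (eqVneq (M a b) 0) => [->|/gM ba].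
  by rewrite mul0r mulr0 if_same.
rewrite [_ * (f a : S)]mulrC mcoeffMX_cond -degP mulrC.
have ba' := deg_mono ba; have bm' : (deg (lab b) <= m)%MM by rewrite degP.
have -> : (deg (lab a) - deg (lab b) <= m - deg (lab b))%MM = (deg (lab a) <= m)%MM.
  apply/mnm_lepP/mnm_lepP => H i; have := H i; rewrite !mnmBE;
  have /mnm_lepP/(_ i) := ba'; have /mnm_lepP/(_ i) := bm'; lia.
case: ifP => _; rewrite ?mul0r //; congr (_@_ _ * _).
apply/mnmP => i; rewrite !mnmBE.
have /mnm_lepP/(_ i) := ba'; have /mnm_lepP/(_ i) := bm'; lia.
Qed.

Local Notation bdry i := (@bdry _ L k i).

Lemma gmap_bdry_exact i : exact_at (gmap (bdry i.+1)) (gmap (bdry i)).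
Proof.
have gb j : graded (bdry j) := @bdry_supp _ L k j.
move=> f; split=> [f0|[g <-]]; last first.
  rewrite [LHS]gmap_comp // (gmap_eq _ (@bdry_bdry _ L k i)).
  exact: gmap0.
have [N fE] := degree_decomposition f.
(* In degree [m] only the chains ending below [flr m] occur, and the cone with [flr m] contracts
   them. *)
exists (\sum_(m : 'X_{1..n < N}) in_degree m (cone (flr m) (component f m))).
rewrite linear_sum [RHS]fE; apply: eq_bigr => m _.
rewrite [LHS]gmap_in_degree //; apply: eq_in_degree => q qm.
apply: bdry_cone => // r rm.
rewrite -component_gmap //; rewrite /= in f0.
by rewrite f0 /component ffunE mcoeff0.
Qed.

(** [gmap] turns the scalar left inverse [N] into an S-linear splitting of the differential, where
    the resolution can be cut off. *)
Lemma bar_resolution (M : lmodType S) (eps : {linear F (@chain _ L 0) -> M}) h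
    (N : @chain _ L h -> @chain _ L h.+1 -> k) :
    surjective_lin eps -> exact_at (gmap (bdry 0)) eps -> graded N ->
    (forall p p', \sum_q bdry h p q * N q p' = (p == p')%:R) ->
  has_proj_resolution M h.
Proof.
move=> eps_surj ex gN NE.
apply: (@has_proj_resolution_split _ (fun i => F (@chain _ L i) : lmodType S)
  (fun i => gmap (bdry i)) M eps h (gmap N)) => //.
- by move=> i; apply: projective_ffun.
- exact: gmap_bdry_exact.
- move=> f; rewrite [LHS]gmap_comp //; last exact: bdry_supp.
  by rewrite (gmap_eq _ NE) gmap_id.
Qed.

End GradedMaps.

(** * The quotient by a monomial ideal as the cokernel of the first differential *)

Section MonomialQuotient.
Variables (k : fieldType) (n : nat) (I : submodClosed {mpoly k[n]}^o).
Local Notation S := {mpoly k[n]}.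
Local Notation L := (lcm_lattice I).
Hypothesis monI : monomial_ideal I.

Definition lcm_floor (m : 'X_{1..n}) : L := lcm_big (fun x : L => (val x <= m)%MM).

Lemma lcm_floorP (x : L) m : (val x <= m)%MM = (x <= lcm_floor m)%O.
Proof.
apply/idP/idP => [xm|]; last first.
  rewrite lcm_leE => /lepm_trans; apply; exact/mlcm_bigP.
have := lexx (lcm_floor m); rewrite {1}lcm_bigP => /forallP/(_ x).
by rewrite xm.
Qed.

Lemma ideal_mulr (p q : S) : q \in I -> p * q \in I.
Proof. by move=> qI; apply: (@rpredZ _ _ I p (q : S^o)). Qed.

Lemma ideal_monomial_le m m' :
  (m <= m')%MM -> ('X_[m] : S) \in I -> ('X_[m'] : S) \in I.
Proof. by move=> mm' mI; rewrite -(submK mm') mpolyXD ideal_mulr. Qed.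

Lemma min_mon_gen_below m : ('X_[m] : S) \in I ->
  exists2 m', m' \in min_mon_gens I & (m' <= m)%MM.
Proof.
have [d] := ubnP (mdeg m); elim: d => // d IHd in m *; rewrite ltnS => md mI.
have [[_ m_min]|not_min] := classic (min_mon_gen I m).
  by exists m; [apply/min_mon_gensP; split | exact: lepm_refl].
have [m1 [m1I m1m m1ne]] : exists m1, [/\ ('X_[m1] : S) \in I, (m1 <= m)%MM & m1 != m].
  apply: NNPP => none; apply: not_min; split=> // m1 m1I m1m.
  by apply/eqP; apply: contraT => ne; case: none; exists m1.
have lt : (mdeg m1 < mdeg m)%N.
  rewrite -(submK m1m) mdegD -[X in (X < _)%N]add0n ltn_add2r lt0n mdeg_eq0.
  by apply: contra m1ne => /eqP e; rewrite -(submK m1m) e add0m.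
have [m' m'I m'm1] := IHd m1 (leq_trans lt md) m1I.
by exists m' => //; apply: lepm_trans m1m.
Qed.

Lemma min_mon_gen_lcm m : m \in min_mon_gens I -> m \in lcms (min_mon_gens I).
Proof.
move=> mG; apply/imageP; exists [set SeqSub mG] => //.
apply: lepm_anti; last by apply/mlcm_bigP => g /set1P ->; apply: lepm_refl.
by have /mlcm_bigP/(_ (SeqSub mG) (set11 _)) :=
  lepm_refl (\big[@mlcm n/0%MM]_(g in [set SeqSub mG]) val g).
Qed.

Lemma monomial_ideal_ind (P : S -> Prop) :
    P 0 -> (forall p q, P p -> P q -> P (p + q)) ->
    (forall p q, P q -> P (p * q)) ->
    (forall m, m \in min_mon_gens I -> P 'X_[m]) ->
  forall p, p \in I -> P p.
Proof.
move=> P0 PD PM PG p; have [G GP] := monI; move=> /GP[s sG ->].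
rewrite big_seq; apply: big_ind => // q /sG Gq; apply/PM.
have : ('X_[q.2] : S) \in I.
  apply/GP; exists [:: (1, q.2)] => [r|]; first by rewrite inE => /eqP ->.
  by rewrite big_seq1 mul1r.
by case/min_mon_gen_below => m mG le; rewrite -(submK le) mpolyXD; apply/PM/PG.
Qed.

Hypothesis L_nontrivial : (\bot : L)%O != \top%O.

(** The monomial 1 divides every generator, so as a generator it would be the only one and the
    lattice would have a single point. *)
Lemma min_mon_gens_neq0 m : m \in min_mon_gens I -> m != 0%MM.
Proof.
move=> mG; apply: contra L_nontrivial => /eqP m0.
have all0 m' : m' \in min_mon_gens I -> m' = 0%MM.
  move=> /min_mon_gensP[_ m'_min]; apply/esym/m'_min.
    by have /min_mon_gensP[] := mG; rewrite m0.
  exact: Defs.le0m.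
rewrite eq_sym -lex0 lcm_leE val_lcm_bottom.
have /imageP[A _ ->] := valP (\top%O : L).
by apply/mlcm_bigP => g _; rewrite (all0 _ (valP g)) lepm_refl.
Qed.

Lemma lcm_lattice_ideal (x : L) : x != \bot%O -> ('X_[val x] : S) \in I.
Proof.
move=> x0; have /imageP[A _ xE] := valP x.
have [A0|[g gA]] := set_0Vmem A.
  case/eqP: x0; apply: val_inj; rewrite val_lcm_bottom.
  by rewrite [LHS]xE A0 big_set0.
have /min_mon_gensP[gI _] := valP g.
apply: ideal_monomial_le gI.
have /mlcm_bigP := lepm_refl (\big[@mlcm n/0%MM]_(g in A) val g).
by rewrite [val x]xE; apply.
Qed.

Local Notation F0 := {ffun lab_car (@chain _ L 0) -> S^o}.

Definition aug (f : F0) : quotmod I := \pi_(quotmod I)%qT (f tt : S^o).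

Fact aug_linear : linear aug.
Proof.
by move=> c f g; rewrite /aug !ffunE quotmod_piD -quotmod_scale_pi.
Qed.
HB.instance Definition _ := GRing.isLinear.Build S F0 (quotmod I) _ aug aug_linear.

Lemma aug_surj : surjective_lin aug.
Proof.
move=> b; exists [ffun=> repr b].
by rewrite /= /aug ffunE reprK.
Qed.

Lemma aug_eq0 f : aug f = 0 <-> (f tt : S) \in I.
Proof.
have -> : (0 : quotmod I) = aug 0 by rewrite linear0.
rewrite /aug ffunE; split=> [/eqP|fI]; first by rewrite quotmod_eq subr0.
by apply/eqP; rewrite quotmod_eq subr0.
Qed.

Lemma bdry0_monomial (p : @chain _ L 1) (q : @chain _ L 0) :
  bdry k p q *: 'X_[val (lab p) - val (lab q)] = 'X_[val (lab p)] :> S.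
Proof.
have -> : lab q = \bot%O by [].
by rewrite val_lcm_bottom subm0 scale1r.
Qed.

(** The image of the differential is spanned by the monomials of the elements of [L] other than
    [\bot]; these lie in [I] and include the minimal generators. *)
Lemma aug_exact :
  exact_at (gmap (fun x : L => val x) (@bdry _ L k 0)) aug.
Proof.
move=> f; rewrite aug_eq0; split=> [fI|[g <-]]; last first.
  rewrite ffunE; apply: (@rpred_sum _ I) => p _.
  rewrite bdry0_monomial [_ * _]mulrC ideal_mulr //.
  apply: lcm_lattice_ideal; rewrite -lt0x.
  exact: le_lt_trans (le0x _) (init_lt p).
pose im (p : S) := exists g, gmap (fun x : L => val x) (@bdry _ L k 0) g = [ffun=> p].
suff [g gE] : im (f tt) by exists g; rewrite [LHS]gE; apply/ffunP => -[]; rewrite ffunE.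
have ffun_tt (p : S) (g : F0) : g tt = p -> g = [ffun=> p].
  by move=> e; apply/ffunP => -[]; rewrite ffunE.
apply: monomial_ideal_ind fI; rewrite /im.
- by exists 0; rewrite linear0; apply/esym/ffun_tt; rewrite ffunE.
- move=> p q [g gE] [g' g'E]; exists (g + g'); rewrite linearD /= gE g'E.
  by apply: ffun_tt; rewrite !ffunE.
- move=> p q [g gE]; exists (p *: g); rewrite linearZ /= gE.
  by apply: ffun_tt; rewrite !ffunE.
move=> m mG; pose x : L := SeqSub (min_mon_gen_lcm mG).
have x0 : x != \bot%O.
  apply: contra (min_mon_gens_neq0 mG) => /eqP/(congr1 val).
  by rewrite val_lcm_bottom => /= ->.
have tx : ((tt : @chain _ L 0), x) \in extension_pred (@chain _ L 0) by rewrite inE /= lt0x.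
pose px : @chain _ L 1 := exist _ (tt, x) tx.
exists [ffun p => (p == px)%:R]; apply: ffun_tt; rewrite ffunE (bigD1 px) // big1.
  by rewrite [LHS]addr0 ffunE eqxx mulr1 bdry0_monomial.
by move=> p /negPf ppx; rewrite ffunE ppx mulr0.
Qed.

End MonomialQuotient.

Theorem theorem5p4 (k : fieldType) (n : nat) (I : submodClosed {mpoly k[n]}^o) :
  monomial_ideal I ->
  proj_dim (quotmod I) (height (lcm_lattice I)) ->
  strongly_complemented (lcm_lattice I).
Proof.
move=> monI [_ min_pd].
have [triv|nontriv] := eqVneq (\bot : lcm_lattice I)%O \top%O.
  (* In a one-point lattice every equation holds, and the empty meet and join serve. *)
  have sub1 (x y : lcm_lattice I) : x = y.
    by apply/le_anti/andP; split; apply: (le_trans (lex1 _)); rewrite -triv le0x.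
  move=> x; exists \top%O, \bot%O; split; try by split; apply: sub1.
    by exists set0; [apply: sub0set | apply: sub1].
  by exists set0; [apply: sub0set | apply: sub1].
have [h hE] : exists h, height (lcm_lattice I) = h.+1.
  exists (height (lcm_lattice I)).-1; rewrite prednK //.
  apply: (@incr_height _ _ 1 (fun i => if i is 0 then \bot else \top)%O) => -[|//] _.
  by rewrite lt0x eq_sym.
pose M (p : @chain _ (lcm_lattice I) h.+1) (q : @chain _ (lcm_lattice I) h) : k :=
  if lab q == \top%O then bdry k p q else 0.
have [[N NE]|[f [p fp] fM]] := left_inverse_or_kernel M.
  (* The height is [h.+1], so a resolution of length [h] contradicts minimality. *)
  suff /min_pd : has_proj_resolution (quotmod I) h by rewrite hE ltnn.
  (* Extended by zero to the chains not ending in [\top], [N] is graded, as every label is below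
     [\top], and still inverts the full differential. *)
  apply: (bar_resolution (@lcm_floorP _ _ I) (aug_surj (I := I))
    (aug_exact monI nontriv) (N := fun q p => if lab q == \top%O then N q p else 0)).
    by move=> q p'; case: (lab q =P \top%O) => [->|_]; rewrite ?lex1 ?eqxx.
  move=> p p'; rewrite -NE; apply: eq_bigr => q _; rewrite /M.
  by case: ifP; rewrite ?mulr0 ?mul0r.
apply: (top_cycle_strongly_complemented hE fp) => q qtop.
rewrite -[RHS](fM q); apply: eq_bigr => p' _.
by rewrite /M qtop eqxx.
Qed.
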